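(* Let $n\ge 2$ be an integer and let $R$ be a one-to-one two-sided matching market. Then $R$ contains a matching of size $n$ and a stable matching of size $\lceil n/2\rceil$ if and only if $R\in\mathcal{F}_n$, where $\mathcal{F}_n$ is the class of markets defined in the context.
   Context: A one-to-one two-sided matching market consists of a finite set of workers, a finite set of firms disjoint from it (not necessarily of the same size), a set of acceptable pairs (worker, firm), namely the pairs in which each party prefers the other to being unmatched, and, for each participant, a strict linear preference order over its acceptable partners (those participants with whom it forms an acceptable pair). Every participant belongs to at least one acceptable pair. A matching is a set of acceptable pairs no two of which share a worker or a firm (so matchings are individually rational); its size is its number of pairs. A matching $\mu$ is stable if there is no blocking pair, i.e. no acceptable pair $(w,f)$ such that $w$ is unmatched in $\mu$ or prefers $f$ to its partner in $\mu$, and $f$ is unmatched in $\mu$ or prefers $w$ to its partner in $\mu$. The class $\mathcal{F}_n$ consists of all markets $R$ that arise by the following construction. Let $P$ be any market with a set $W$ of $\lceil n/2\rceil$ workers and a set $F$ of $\lceil n/2\rceil$ firms that contains a stable matching $\mu$ of size $\lceil n/2\rceil$. Add a finite set $W'$ of at least $\lfloor n/2\rfloor$ new workers and a finite set $F'$ of at least $\lfloor n/2\rfloor$ new firms to obtain a market $R$ with workers $W\cup W'$ and firms $F\cup F'$ such that: (1) the acceptable pairs of $R$ in $W\times F$ are exactly those of $P$, and the preferences of $R$ among these pairs are those of $P$; (2) for every $(w,f)\in\mu$ and every $w'\in W'$ such that $(w',f)$ is acceptable in $R$, $f$ prefers $w$ to $w'$; (3) for every $(w,f)\in\mu$ and every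 $f'\in F'$ such that $(w,f')$ is acceptable in $R$, $w$ prefers $f$ to $f'$; (4) no pair $(w',f')$ with $w'\in W'$, $f'\in F'$ is acceptable in $R$; (5) $R$ contains a matching of size $n$. Everything not specified by $P$ or by these rules (which pairs in $W\times F'$ and $W'\times F$ are acceptable, and all remaining preference comparisons) is arbitrary. *)

(* Defs.v *)
From HB Require Import structures.
From mathcomp Require Import all_boot.
Set Implicit Arguments.
Unset Strict Implicit.
Unset Printing Implicit Defensive.

Definition strict_linear_on (T : finType) (A : {set T}) (r : rel T) : Prop :=
  [/\ {in A, irreflexive r},
      {in A & &, transitive r}
    & {in A &, forall x y, x != y -> r x y || r y x}].

(* Participants are drawn from two ambient types, so that workers and firms
   are disjoint and one market can be enlarged to another by literal unions.
   Preferences are strict: [worker_prefers w f1 f2] reads "w prefers f1 to f2";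
   their values outside the acceptable partners are irrelevant. *)
Record market (U V : finType) := Market {
  workers : {set U};
  firms : {set V};
  acceptable : {set U * V};
  worker_prefers : U -> rel V;
  firm_prefers : V -> rel U;
  acceptable_sub : acceptable \subset setX workers firms;
  worker_prefers_linear : {in workers, forall w,
    strict_linear_on [set f | (w, f) \in acceptable] (worker_prefers w)};
  firm_prefers_linear : {in firms, forall f,
    strict_linear_on [set w | (w, f) \in acceptable] (firm_prefers f)};
  worker_acceptable : {in workers, forall w, exists f, (w, f) \in acceptable};
  firm_acceptable : {in firms, forall f, exists w, (w, f) \in acceptable}
}.

Section Matchings.

Variables (U V : finType).
Implicit Types (R P : market U V) (mu : {set U * V}).

Definition is_matching R mu : Prop :=
  [/\ mu \subset acceptable R, {in mu &, injective fst}
    & {in mu &, injective snd}].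

Definition blocking_pair R mu (w : U) (f : V) : Prop :=
  [/\ (w, f) \in acceptable R,
      (forall f', (w, f') \notin mu) \/
        (exists2 f', (w, f') \in mu & worker_prefers R w f f')
    & (forall w', (w', f) \notin mu) \/
        (exists2 w', (w', f) \in mu & firm_prefers R f w w')].

Definition is_stable R mu : Prop :=
  is_matching R mu /\ forall w f, ~ blocking_pair R mu w f.

Definition extends_market P R : Prop :=
  [/\ acceptable R :&: setX (workers P) (firms P) = acceptable P,
      forall w f1 f2, (w, f1) \in acceptable P -> (w, f2) \in acceptable P ->
        worker_prefers R w f1 f2 = worker_prefers P w f1 f2
    & forall f w1 w2, (w1, f) \in acceptable P -> (w2, f) \in acceptable P ->
        firm_prefers R f w1 w2 = firm_prefers P f w1 w2].

(* [R] is obtained from [P] and its stable matching [mu] by adding the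
   participants [W'] and [F']; [uphalf n] and [n./2] are the ceiling and the
   floor of n/2. *)
Definition Fn_construction (n : nat) P mu (W' : {set U}) (F' : {set V}) R
    : Prop :=
  [/\ [/\ #|workers P| = uphalf n, #|firms P| = uphalf n, is_stable P mu
        & #|mu| = uphalf n],
      [/\ [disjoint workers P & W'], [disjoint firms P & F'], n./2 <= #|W'|
        & n./2 <= #|F'|],
      workers R = workers P :|: W' /\ firms R = firms P :|: F'
    & [/\ extends_market P R,
          forall w f w', (w, f) \in mu -> w' \in W' ->
            (w', f) \in acceptable R -> firm_prefers R f w w',
          forall w f f', (w, f) \in mu -> f' \in F' ->
            (w, f') \in acceptable R -> worker_prefers R w f f',
          forall w' f', w' \in W' -> f' \in F' -> (w', f') \notin acceptable R
        & exists2 M, is_matching R M & #|M| = n]].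

Definition in_Fn (n : nat) R : Prop :=
  exists P mu W' F', Fn_construction n P mu W' F' R.

End Matchings.

(* Main.v *)
Require Import Defs.
From HB Require Import structures.
From mathcomp Require Import all_boot.
Set Implicit Arguments.
Unset Strict Implicit.
Unset Printing Implicit Defensive.

(** Given a stable matching [mu] of [R], let [P] be the restriction of [R] to the
participants matched by [mu], the others being the new ones: rules (2)-(4) say
exactly that no pair with a participant outside [P] blocks [mu].  Conversely,
[mu] is perfect in [P], so a pair of [R] blocking it either lies in [P], or
contradicts one of the rules (2)-(4). *)

Lemma strict_linear_on_subset (T : finType) (A B : {set T}) (r : rel T) :
  B \subset A -> strict_linear_on A r -> strict_linear_on B r.
Proof.
move=> /subsetP sBA [irr tr tot]; split.
- by move=> x /sBA; apply: irr.
- by move=> x y z /sBA xA /sBA yA /sBA zA; apply: tr.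
- by move=> x y /sBA xA /sBA yA; apply: tot.
Qed.

Lemma strict_linear_on_asym (T : finType) (A : {set T}) (r : rel T) x y :
  strict_linear_on A r -> x \in A -> y \in A -> r x y -> ~ r y x.
Proof.
move=> [irr tr _] xA yA rxy ryx.
by have := tr y x x yA xA xA rxy ryx; rewrite irr.
Qed.

Section Markets.

Variables (U V : finType).
Implicit Types (R P : market U V) (mu : {set U * V}) (w : U) (f : V).

Lemma acceptable_participants R w f :
  (w, f) \in acceptable R -> w \in workers R /\ f \in firms R.
Proof. by move=> /(subsetP (acceptable_sub R)); rewrite in_setX => /andP. Qed.

Lemma worker_prefers_asym R w f1 f2 :
  (w, f1) \in acceptable R -> (w, f2) \in acceptable R ->
  worker_prefers R w f1 f2 -> ~ worker_prefers R w f2 f1.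
Proof.
move=> a1 a2; have [wR _] := acceptable_participants a1.
by apply: strict_linear_on_asym (worker_prefers_linear wR) _ _; rewrite inE.
Qed.

Lemma firm_prefers_asym R f w1 w2 :
  (w1, f) \in acceptable R -> (w2, f) \in acceptable R ->
  firm_prefers R f w1 w2 -> ~ firm_prefers R f w2 w1.
Proof.
move=> a1 a2; have [_ fR] := acceptable_participants a1.
by apply: strict_linear_on_asym (firm_prefers_linear fR) _ _; rewrite inE.
Qed.

Lemma worker_prefers_total R w f1 f2 :
  (w, f1) \in acceptable R -> (w, f2) \in acceptable R -> f1 != f2 ->
  worker_prefers R w f1 f2 || worker_prefers R w f2 f1.
Proof.
move=> a1 a2; have [wR _] := acceptable_participants a1.
by have [_ _ tot] := worker_prefers_linear wR; apply: tot; rewrite inE.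
Qed.

Lemma firm_prefers_total R f w1 w2 :
  (w1, f) \in acceptable R -> (w2, f) \in acceptable R -> w1 != w2 ->
  firm_prefers R f w1 w2 || firm_prefers R f w2 w1.
Proof.
move=> a1 a2; have [_ fR] := acceptable_participants a1.
by have [_ _ tot] := firm_prefers_linear fR; apply: tot; rewrite inE.
Qed.

Lemma matched_workers_sub R mu :
  is_matching R mu -> [set p.1 | p in mu] \subset workers R.
Proof.
move=> [/subsetP sub _ _]; apply/subsetP=> _ /imsetP[[w f] /sub a ->].
by have [] := acceptable_participants a.
Qed.

Lemma matched_firms_sub R mu :
  is_matching R mu -> [set p.2 | p in mu] \subset firms R.
Proof.
move=> [/subsetP sub _ _]; apply/subsetP=> _ /imsetP[[w f] /sub a ->].
by have [] := acceptable_participants a.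
Qed.

Lemma card_matched_workers R mu :
  is_matching R mu -> #|[set p.1 | p in mu]| = #|mu|.
Proof. by case=> _ inj _; apply: card_in_imset. Qed.

Lemma card_matched_firms R mu :
  is_matching R mu -> #|[set p.2 | p in mu]| = #|mu|.
Proof. by case=> _ _ inj; apply: card_in_imset. Qed.

(** The matched workers form a subset of [workers R] with [#|mu|] elements, so equality of
    cardinalities makes it all of [workers R]. *)
Lemma perfect_worker_matched R mu w :
  is_matching R mu -> #|mu| = #|workers R| -> w \in workers R ->
  exists f, (w, f) \in mu.
Proof.
move=> mR card_mu.
have /eqP <- : [set p.1 | p in mu] == workers R.
  by rewrite eqEcard matched_workers_sub // (card_matched_workers mR) card_mu leqnn.
by case/imsetP=> -[w' f] muf ->; exists f.
Qed.

Lemma perfect_firm_matched R mu f :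
  is_matching R mu -> #|mu| = #|firms R| -> f \in firms R ->
  exists w, (w, f) \in mu.
Proof.
move=> mR card_mu.
have /eqP <- : [set p.2 | p in mu] == firms R.
  by rewrite eqEcard matched_firms_sub // (card_matched_firms mR) card_mu leqnn.
by case/imsetP=> -[w f'] muf ->; exists w.
Qed.

Section Restriction.

Variables (R : market U V) (mu : {set U * V}).
Hypothesis mR : is_matching R mu.

Let W := [set p.1 | p in mu].
Let F := [set p.2 | p in mu].
Let A := acceptable R :&: setX W F.

Let mu_sub_A : mu \subset A.
Proof.
have [sub _ _] := mR; rewrite subsetI sub /=.
apply/subsetP=> p mup; rewrite inE.
by rewrite !imset_f.
Qed.

Fact restriction_worker_prefers_linear : {in W, forall w,
  strict_linear_on [set f | (w, f) \in A] (worker_prefers R w)}.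
Proof.
move=> w /(subsetP (matched_workers_sub mR)) /worker_prefers_linear.
by apply: strict_linear_on_subset; apply/subsetP=> f; rewrite !inE => /andP[].
Qed.

Fact restriction_firm_prefers_linear : {in F, forall f,
  strict_linear_on [set w | (w, f) \in A] (firm_prefers R f)}.
Proof.
move=> f /(subsetP (matched_firms_sub mR)) /firm_prefers_linear.
by apply: strict_linear_on_subset; apply/subsetP=> w; rewrite !inE => /andP[].
Qed.

Fact restriction_worker_acceptable :
  {in W, forall w, exists f, (w, f) \in A}.
Proof.
by move=> _ /imsetP[[w f] muf ->]; exists f; apply: (subsetP mu_sub_A).
Qed.

Fact restriction_firm_acceptable :
  {in F, forall f, exists w, (w, f) \in A}.
Proof.
by move=> _ /imsetP[[w f] muf ->]; exists w; apply: (subsetP mu_sub_A).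
Qed.

(** The preference relations of [R] are kept unchanged, since their values outside [A] do not
    matter; hence [extends_market] holds by computation. Each participant has an acceptable partner,
    namely its partner in [mu]. *)
Definition matched_market : market U V :=
  Market (subsetIr _ _) restriction_worker_prefers_linear
    restriction_firm_prefers_linear restriction_worker_acceptable
    restriction_firm_acceptable.

Lemma matched_market_extends : extends_market matched_market R.
Proof. by []. Qed.

(** Acceptability is only restricted and preferences are the same, so a pair blocking [mu] in the
    restriction already blocks it in [R]. *)
Lemma matched_market_stable : is_stable R mu -> is_stable matched_market mu.
Proof.
move=> [[_ inj1 inj2] stab]; split; first by split.
move=> w f [/setIP[a _] bw bf]; exact: (stab w f).
Qed.

End Restriction.

Lemma unmatched_worker R mu w f :
  w \notin [set p.1 | p in mu] -> (w, f) \notin mu.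
Proof. by apply: contraNN => muf; apply/imsetP; exists (w, f). Qed.

Lemma unmatched_firm R mu w f :
  f \notin [set p.2 | p in mu] -> (w, f) \notin mu.
Proof. by apply: contraNN => muf; apply/imsetP; exists (w, f). Qed.

Lemma stable_in_Fn n R M mu :
  is_matching R M -> #|M| = n -> is_stable R mu -> #|mu| = uphalf n ->
  in_Fn n R.
Proof.
move=> mM cM sR cmu; have [mR stab] := sR; have [/subsetP sub _ _] := mR.
exists (matched_market mR), mu, (workers R :\: [set p.1 | p in mu]),
  (firms R :\: [set p.2 | p in mu]).
have half_n : n - uphalf n = n./2 by rewrite -{1}(odd_double_half n) uphalf_half -addnn addnA addKn.
split.
- by split; rewrite ?(card_matched_workers mR) ?(card_matched_firms mR) //;
    apply: matched_market_stable.
(* The matching [M] forces at least [n] participants on each side of [R]; removing the [uphalf n]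
   matched by [mu] leaves at least [n - uphalf n = n./2]. *)
- split; rewrite /= ?disjoints_subset ?setDE ?setCI ?setCK ?subsetUr //.
  + rewrite -setDE cardsD (setIidPr (matched_workers_sub mR)).
    rewrite (card_matched_workers mR) cmu -half_n leq_sub2r // -cM.
    by rewrite -(card_matched_workers mM) subset_leq_card ?matched_workers_sub.
  + rewrite -setDE cardsD (setIidPr (matched_firms_sub mR)).
    rewrite (card_matched_firms mR) cmu -half_n leq_sub2r // -cM.
    by rewrite -(card_matched_firms mM) subset_leq_card ?matched_firms_sub.
- split; rewrite /= setDE setUIr setUCr setIT; apply/esym/setUidPr.
  + exact: matched_workers_sub.
  + exact: matched_firms_sub.
split.
- exact: matched_market_extends.
- move=> w f w' muf /setDP[_ w'un] a'.
  (* Since [w'] is unmatched, it differs from [w], and by totality [f] ranks the two. If [f]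
     preferred [w'], the pair [(w', f)] would block [mu]. *)
  have neq : w != w' by apply: contraNneq w'un => <-; apply: (imset_f fst muf).
  have /orP[//|bl] := firm_prefers_total (sub _ muf) a' neq.
  case: (stab w' f); split=> //; last by right; exists w.
  by left=> f'; apply: unmatched_worker.
- move=> w f f' muf /setDP[_ f'un] a'.
  have neq : f != f' by apply: contraNneq f'un => <-; apply: (imset_f snd muf).
  have /orP[//|bl] := worker_prefers_total (sub _ muf) a' neq.
  case: (stab w f'); split=> //; first by right; exists f.
  by left=> w'; apply: unmatched_firm.
(* Two unmatched participants that accept each other would block [mu]. *)
- move=> w f /setDP[_ wun] /setDP[_ fun_]; apply/negP=> a.
  case: (stab w f); split=> //.
  + by left=> f'; apply: unmatched_worker.
  + by left=> w'; apply: unmatched_firm.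
- by exists M.
Qed.

Lemma Fn_construction_stable n P mu (W' : {set U}) (F' : {set V}) R :
  Fn_construction n P mu W' F' R -> is_stable R mu.
Proof.
move=> [[cW cF [mP stabP] cmu] _ [eW eF] [[eA eWp eFp] r2 r3 r4 _]].
have [subP inj1 inj2] := mP.
have sAPR : acceptable P \subset acceptable R by rewrite -eA subsetIl.
have muR := subsetP (subset_trans subP sAPR).
have matchedW w : w \in workers P -> exists f, (w, f) \in mu.
  by apply: perfect_worker_matched; rewrite // cmu cW.
have matchedF f : f \in firms P -> exists w, (w, f) \in mu.
  by apply: perfect_firm_matched; rewrite // cmu cF.
split; first by split=> //; apply: subset_trans sAPR.
move=> w f [a bw bf].
have [] := acceptable_participants a; rewrite eW eF !inE.
(* Members of [P] are all matched by [mu], so for them the blocking condition can only mean a strict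
   improvement on the current partner. *)
have improvesW : w \in workers P ->
    exists2 f', (w, f') \in mu & worker_prefers R w f f'.
  by case: bw => // un /matchedW[f']; rewrite (negPf (un f')).
have improvesF : f \in firms P ->
    exists2 w', (w', f) \in mu & firm_prefers R f w w'.
  by case: bf => // un /matchedF[w']; rewrite (negPf (un w')).
(* Four cases, by whether [w] and [f] are old or new. If just one is new, rule (2) or (3) makes the
   old one prefer its partner, against asymmetry; if both are new, rule (4) excludes the pair. *)
have [wP _|_ /= wW'] := boolP (w \in workers P); last first.
  have [/improvesF[w' muw' pref] _|_ /= fF'] := boolP (f \in firms P).
    by apply: (firm_prefers_asym a (muR _ muw') pref); apply: r2 muw' wW' a.
  by have := r4 _ _ wW' fF'; rewrite a.
have [f' muf' prefW] := improvesW wP.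
have [fP _|_ /= fF'] := boolP (f \in firms P); last first.
  by apply: (worker_prefers_asym a (muR _ muf') prefW); apply: r3 muf' fF' a.
have [w' muw' prefF] := improvesF fP.
(* Both are old: by rule (1) the pair is acceptable in [P] and the comparisons carry over, so it
   would block [mu] in [P]. *)
have aP : (w, f) \in acceptable P by rewrite -eA inE a in_setX wP fP.
apply: (stabP w f); split=> //; right.
- by exists f'; rewrite // -eWp //; apply: (subsetP subP).
- by exists w'; rewrite // -eFp //; apply: (subsetP subP).
Qed.

End Markets.

Theorem theorem2 (U V : finType) (n : nat) (R : market U V) (hn : 2 <= n) :
  (exists2 M : {set U * V}, is_matching R M & #|M| = n) /\
  (exists2 mu : {set U * V}, is_stable R mu & #|mu| = uphalf n)
  <-> in_Fn n R.
Proof.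
split=> [[[M mM cM] [mu smu cmu]]|[P [mu [W' [F' cons]]]]].
  exact: stable_in_Fn mM cM smu cmu.
have smu := Fn_construction_stable cons.
have [[_ _ _ cmu] _ _ [_ _ _ _ exM]] := cons.
by split=> //; exists mu.
Qed.
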